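(* Let $(X,\mathcal{F},\mu)$ be a charge space and $f:X\rightarrow\mathbb{R}$ a function. Suppose $\phi_f^{-1}[0,\infty)$ is dense in $\mathbb{R}$, where $\phi_f$ is the boundary mass limit of $f$. 1. The following statements are logically equivalent: (a) $f$ is ray measurable; (b) $f$ is left ray measurable; (c) $f$ is right ray measurable; (d) $f$ is $\overline{\mathcal{F}}$-measurable; (e) $f^+$ and $f^-$ are base measurable; (f) $f$ is base measurable and there exists $y\in\mathbb{R}$ with $f^{-1}(y,\infty)\in\overline{\mathcal{F}}$. 2. The following statements are logically equivalent: (a) $f$ is regularly $T_1$-measurable; (b) $f$ is $T_1$-measurable; (c) $f$ is $T_2$-measurable; (d) $f$ is ray measurable and smooth; (e) $f$ is base measurable and smooth.
   Context: A charge space $(X,\mathcal{F},\mu)$ is a set $X$, a field (algebra) $\mathcal{F}$ of subsets of $X$, and a positive charge $\mu:\mathcal{F}\to[0,\infty]$, i.e. a finitely additive set function with $\mu(\emptyset)=0$ (possibly $\mu(X)=\infty$). For $A\subseteq X$: outer charge $\mu^*(A)=\inf\{\mu(B):B\in\mathcal{F},B\supseteq A\}$, inner charge $\mu_*(A)=\sup\{\mu(B):B\in\mathcal{F},B\subseteq A\}$. The Peano-Jordan completion $\overline{\mathcal{F}}$ is the field of all $A\subseteq X$ such that for every $\epsilon>0$ there are $B,C\in\mathcal{F}$ with $B\subseteq A\subseteq C$ and $\mu(C\setminus B)<\epsilon$. The boundary mass limit $\phi_f:\mathbb{R}\to[0,\infty]$ is $\phi_f(z)=\lim_{\delta\to0^+}\mu_*(f^{-1}(z-\delta,z+\delta))$.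 Write $f^+=\max\{f,0\}$, $f^-=\max\{-f,0\}$; $I_A$ is the indicator function of $A$; $\mathbb{N}=\{1,2,\ldots\}$. A simple function (resp. $\overline{\mathcal{F}}$-simple function) is a real-valued function with finitely many values whose level sets are in $\mathcal{F}$ (resp. $\overline{\mathcal{F}}$). A sequence $s_i:X\to\mathbb{R}$ converges hazily to $f$ if $\mu^*(\{x:|s_i(x)-f(x)|>\epsilon\})\to0$ for every $\epsilon>0$. A function $f:X\to\mathbb{R}$ is: - right ray measurable if there is a dense $D\subseteq\mathbb{R}$ with $f^{-1}(y,\infty)\in\overline{\mathcal{F}}$ for all $y\in D$; - left ray measurable if there is a dense $D\subseteq\mathbb{R}$ with $f^{-1}(-\infty,y)\in\overline{\mathcal{F}}$ for all $y\in D$; - ray measurable if there is a dense $D\subseteq\mathbb{R}$ with both $f^{-1}(y,\infty)\in\overline{\mathcal{F}}$ and $f^{-1}(-\infty,y)\in\overline{\mathcal{F}}$ for all $y\in D$; - $\overline{\mathcal{F}}$-measurable if for each $h\in\{f^+,f^-\}$ and all $a,b\in(0,\infty)$ with $a>b$ there is $H\in\overline{\mathcal{F}}$ with $h^{-1}(a,\infty)\subseteq H\subseteq h^{-1}(b,\infty)$; - base measurable if each $y\in\mathbb{R}$ has a neighbourhood base $\mathcal{B}_y$ in the usual topology of $\mathbb{R}$ (neighbourhoods need not be open) with $f^{-1}(B)\in\overline{\mathcal{F}}$ for all $B\in\mathcal{B}_y$; - smooth if for every $\epsilon>0$ there is $k\in(0,\infty)$ with $\mu^*(\{x:|f(x)|>k\})<\epsilon$;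 - $T_1$-measurable if there is a sequence of simple functions converging hazily to $f$; - $T_2$-measurable if for every $\epsilon>0$ there is a partition of $X$ into (possibly empty) sets $A_0,\ldots,A_n\in\mathcal{F}$ with $\mu(A_0)<\epsilon$ and $|f(x)-f(x')|<\epsilon$ for all $x,x'\in A_i$, $i\in\{1,\ldots,n\}$; - regularly $T_1$-measurable if there is a sequence $\{s_i\}_{i=1}^\infty$ of $\overline{\mathcal{F}}$-simple functions converging hazily to $f$ such that, for some $\delta>0$: $s_i=\sum_{k=1}^{n_i}y_{ik}(I_{A_{ik}^+}-I_{A_{ik}^-})$ with $n_i=i2^i-1$; $y_{ik}=k2^{-i}\delta$ for $k\in\{1,\ldots,n_i+1\}$, $i\in\mathbb{N}$; and $A_{ik}^+=f^{-1}(y_{ik},y_{i,k+1}]\in\overline{\mathcal{F}}$, $A_{ik}^-=f^{-1}[-y_{i,k+1},-y_{ik})\in\overline{\mathcal{F}}$ for each $k\in\{1,\ldots,n_i\}$, $i\in\mathbb{N}$. *)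

(* Defs.v *)
From mathcomp Require Import all_boot all_order all_algebra.
From mathcomp Require Import all_classical all_reals all_analysis.

Set Implicit Arguments.
Unset Strict Implicit.
Unset Printing Implicit Defensive.

Import Order.TTheory GRing.Theory Num.Theory.
Import numFieldNormedType.Exports.

Local Open Scope classical_set_scope.
Local Open Scope ring_scope.

(* Fields of sets are given as set systems, and not as instances of
   algebraOfSetsType, because the latter requires the carrier to be pointed,
   which would exclude the empty set as underlying space. *)
Definition is_field_of_sets (X : Type) (F : set (set X)) : Prop :=
  setring F /\ F [set: X].

(* A charge is a total function on [set X] of which only the values on F are
   constrained; the definitions below only evaluate it on members of F. *)
Definition is_charge (R : realType) (X : Type) (F : set (set X))
    (mu : set X -> \bar R) : Prop :=
  [/\ mu set0 = 0%E,
      forall A, F A -> (0 <= mu A)%E &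
      forall A B, F A -> F B -> A `&` B = set0 ->
        mu (A `|` B) = (mu A + mu B)%E].

Section ChargeSpace.
Context (R : realType) (X : Type) (F : set (set X)) (mu : set X -> \bar R).
Implicit Types (A : set X) (f h : X -> R) (s : nat -> X -> R).

Definition outer_charge A : \bar R :=
  ereal_inf [set mu B | B in [set B | F B /\ A `<=` B]].

Definition inner_charge A : \bar R :=
  ereal_sup [set mu B | B in [set B | F B /\ B `<=` A]].

Definition pj_completion : set (set X) :=
  [set A | forall e : R, 0 < e ->
    exists B C : set X,
      [/\ F B, F C, B `<=` A, A `<=` C & (mu (C `\` B) < e%:E)%E]].

Definition boundary_mass_limit f (z : R) : \bar R :=
  lim (inner_charge (f @^-1` `]z - d, z + d[) @[d --> 0^'+]).

(* Level sets of values that are not taken are empty, hence always in G. *)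
Definition simple_function (G : set (set X)) (h : X -> R) : Prop :=
  finite_set (range h) /\ forall y : R, G (h @^-1` [set y]).

Definition converges_hazily s f : Prop :=
  forall e : R, 0 < e ->
    outer_charge [set x | e < `|s i x - f x|] @[i --> \oo] --> 0%E.

Definition right_ray_measurable f : Prop :=
  exists D : set R, dense D /\
    forall y, D y -> pj_completion (f @^-1` `]y, +oo[).

Definition left_ray_measurable f : Prop :=
  exists D : set R, dense D /\
    forall y, D y -> pj_completion (f @^-1` `]-oo, y[).

Definition ray_measurable f : Prop :=
  exists D : set R, dense D /\
    forall y, D y -> pj_completion (f @^-1` `]y, +oo[) /\
                     pj_completion (f @^-1` `]-oo, y[).

Definition completion_measurable f : Prop :=
  forall h, [set f^\+; f^\-] h ->
  forall a b : R, 0 < a -> 0 < b -> b < a ->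
    exists2 H : set X, pj_completion H &
      h @^-1` `]a, +oo[ `<=` H /\ H `<=` h @^-1` `]b, +oo[.

Definition neighbourhood_base (y : R) (B : set (set R)) : Prop :=
  B `<=` nbhs y /\ forall U, nbhs y U -> exists2 V, B V & V `<=` U.

Definition base_measurable f : Prop :=
  forall y : R, exists2 B : set (set R), neighbourhood_base y B &
    forall V, B V -> pj_completion (f @^-1` V).

Definition smooth f : Prop :=
  forall e : R, 0 < e ->
    exists2 k : R, 0 < k & (outer_charge [set x | (k < `|f x|)%R] < e%:E)%E.

Definition T1_measurable f : Prop :=
  exists2 s, (forall i, simple_function F (s i)) & converges_hazily s f.

Definition T2_measurable f : Prop :=
  forall e : R, 0 < e ->
    exists (n : nat) (A : nat -> set X),
      [/\ forall i, (i <= n)%N -> F (A i),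
          trivIset `I_n.+1 A,
          \bigcup_(i < n.+1) A i = setT,
          (mu (A 0%N) < e%:E)%E &
          forall i, (1 <= i <= n)%N ->
            forall x x', A i x -> A i x' -> `|f x - f x'| < e].

Definition dyadic_level (delta : R) (i k : nat) : R := k%:R * 2 ^- i * delta.

Definition dyadic_pos_part f (delta : R) (i k : nat) : set X :=
  f @^-1` `]dyadic_level delta i k, dyadic_level delta i k.+1].

Definition dyadic_neg_part f (delta : R) (i k : nat) : set X :=
  f @^-1` `[- dyadic_level delta i k.+1, - dyadic_level delta i k[.

(* The approximating sequence is indexed from 1: the function [s 0] is not
   constrained. *)
Definition regularly_T1_measurable f : Prop :=
  exists s,
    [/\ forall i, (1 <= i)%N -> simple_function pj_completion (s i),
        converges_hazily s f &
        exists2 delta : R, 0 < delta &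
          forall i, (1 <= i)%N ->
            (forall k, (1 <= k <= i * 2 ^ i - 1)%N ->
               pj_completion (dyadic_pos_part f delta i k) /\
               pj_completion (dyadic_neg_part f delta i k)) /\
            forall x, s i x =
              \sum_(1 <= k < (i * 2 ^ i - 1).+1)
                dyadic_level delta i k *
                  (\1_(dyadic_pos_part f delta i k) x -
                   \1_(dyadic_neg_part f delta i k) x)].

End ChargeSpace.

(* Main.v *)
Require Import Defs.
From mathcomp Require Import all_boot all_order all_algebra.
From mathcomp Require Import all_classical all_reals all_analysis.
From mathcomp Require Import lra.

Set Implicit Arguments.
Unset Strict Implicit.
Unset Printing Implicit Defensive.

Import Order.TTheory GRing.Theory Num.Theory.
Import numFieldNormedType.Exports.

Local Open Scope classical_set_scope.
Local Open Scope ring_scope.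

(** Everything is reduced to one condition, [ray_separated]: for [b < a], the ray
set [{f > a}] is contained in [{f > b}] up to a set of arbitrarily small
charge, where containment up to charge [e] ([almost_sub]) means that members
[B] and [C] of the field exist with [{f > a} <= C], [B <= {f > b}] and
[mu (C \ B) < e].  A set belongs to the Peano-Jordan completion exactly when it
is almost contained in itself for every [e], so this is a version of
right ray measurability which tolerates a gap between the two levels.

Each of the conditions of the theorem gives ray separation without
the hypothesis on the boundary mass limit.  For the ray conditions a level of
the dense set is found between [b] and [a]; for base measurability the segment
between [a] and a level at which something is known (a measurable ray, or a
level beyond which smoothness makes [|f|] negligible) is compact, hence covered
by one set with preimage in the completion which stays on the right side of
[b]; for T2-measurability the blocks of a fine partition which meet [{f > a}]
do the job.

Conversely, let the boundary mass limit be finite on a dense set.  A point [y]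
has a small jump ([small_jump]) if [{f > y1}] is almost contained in
[{f >= y2}] for some [y1 < y < y2].  Such points form an open set, and ray
separation makes it dense ([small_jump_dense]): an interval without small
jumps can be halved repeatedly, every piece carries a fixed amount of charge, so
the inner charge of its preimage is infinite, which the hypothesis
excludes on some interval near any given point.  By Baire's theorem the
points where the jump is smaller than every [e] are dense, and at such a point
both rays belong to the completion ([ray_separated_ray_measurable]).  That gives
ray measurability, from which the other conditions of the first list are
immediate.

In the second list the delicate point is regular T1-measurability, which asks
for one [delta] such that all levels [k 2^-i delta] and their opposites are
continuity points of this kind.  A countability argument is not available,
because the boundary mass limit may be infinite on a set of positive Lebesgue
measure; but the exceptional set is meagre, and so are its countably many
rescalings, so that Baire's theorem provides [delta]
([continuity_points_comeager]).  The dyadic sums then approximate [f] up to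
[2^-i delta] wherever [|f| <= i delta], and smoothness controls the rest. *)

(** * Fields of sets *)

Section FieldOfSets.
Context (X : Type) (G : set (set X)) (hG : is_field_of_sets G).

Lemma field_set0 : G set0. Proof. by case: hG => -[]. Qed.

Lemma field_setT : G setT. Proof. by case: hG. Qed.

Lemma field_setU A B : G A -> G B -> G (A `|` B).
Proof. by case: hG => -[_ + _ _]; exact. Qed.

Lemma field_setD A B : G A -> G B -> G (A `\` B).
Proof. by case: hG => -[_ _ + _]; exact. Qed.

Lemma field_setC A : G A -> G (~` A).
Proof. by rewrite -setTD; apply: field_setD; exact: field_setT. Qed.

Lemma field_setI A B : G A -> G B -> G (A `&` B).
Proof.
by move=> GA GB; rewrite -setDD; apply: field_setD => //; exact: field_setD.
Qed.

Lemma field_bigcup n (A : nat -> set X) :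
  (forall i, (i < n)%N -> G (A i)) -> G (\bigcup_(i < n) A i).
Proof.
elim: n => [|n IH] GA; first by rewrite II0 bigcup_set0; exact: field_set0.
rewrite IIS bigcup_setU bigcup_set1; apply: field_setU; last exact: GA.
by apply: IH => i lin; apply: GA; exact: ltnW.
Qed.

Lemma field_finite_bigcup (I : choiceType) (D : set I) (A : I -> set X) :
  finite_set D -> (forall i, D i -> G (A i)) -> G (\bigcup_(i in D) A i).
Proof.
move=> /finite_setP[n]; elim: n D => [|n IH] D.
  by rewrite II0 card_eq0 => /eqP-> _; rewrite bigcup_set0; exact: field_set0.
move=> /eq_cardSP[i Di Dn] GA.
rewrite -(setD1K Di) bigcup_setU bigcup_set1.
apply: field_setU; first exact: GA.
by apply: IH => // j [Dj _]; exact: GA.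
Qed.

End FieldOfSets.

(** * Charges, almost inclusion and the Peano-Jordan completion *)

Section ChargeSpace.
Context (R : realType) (X : Type) (F : set (set X)) (mu : set X -> \bar R).
Context (hF : is_field_of_sets F) (hmu : is_charge F mu).

Lemma charge_set0 : mu set0 = 0%E. Proof. by case: hmu. Qed.

Lemma charge_ge0 A : F A -> (0 <= mu A)%E.
Proof. by case: hmu => _ + _; exact. Qed.

Lemma charge_disjointU A B : F A -> F B -> A `&` B = set0 ->
  mu (A `|` B) = (mu A + mu B)%E.
Proof. by case: hmu => _ _; exact. Qed.

Lemma charge_le A B : F A -> F B -> A `<=` B -> (mu A <= mu B)%E.
Proof.
move=> FA FB AB; rewrite -(setDUK AB) charge_disjointU ?setDIK//.
  by rewrite leeDl// charge_ge0//; exact: field_setD.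
exact: field_setD.
Qed.

Lemma charge_subadditive A B : F A -> F B -> (mu (A `|` B) <= mu A + mu B)%E.
Proof.
move=> FA FB; have -> : A `|` B = A `|` (B `\` A).
  by rewrite setDE setUIr setUCr setIT.
rewrite charge_disjointU ?setDIK//; last exact: field_setD.
by rewrite leeD2l// charge_le//; exact: field_setD.
Qed.

Lemma charge_lt_cover2 (e1 e2 : R) A B C : F A -> F B -> F C ->
  A `<=` B `|` C -> (mu B < e1%:E)%E -> (mu C < e2%:E)%E ->
  (mu A < (e1 + e2)%:E)%E.
Proof.
move=> FA FB FC ABC Be Ce; apply: (le_lt_trans (charge_le FA _ ABC)).
  exact: field_setU.
apply: (le_lt_trans (charge_subadditive FB FC)).
by rewrite EFinD; exact: lteD.
Qed.

(** [A] is approximated from outside and [A'] from inside, so that neither needs to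
be measurable and membership in the completion is the case [A = A'].  It is
allowed that [A'] is the smaller set. *)
Definition almost_sub (e : R) (A A' : set X) := exists B C : set X,
  [/\ F B, F C, A `<=` C, B `<=` A' & (mu (C `\` B) < e%:E)%E].

Lemma almost_sub_mono (e e' : R) A A' B B' : e <= e' -> A' `<=` A -> B `<=` B' ->
  almost_sub e A B -> almost_sub e' A' B'.
Proof.
move=> ee' A'A BB' [C [D [FC FD AD CB CDe]]]; exists C, D; split=> //.
- exact: subset_trans AD.
- exact: subset_trans BB'.
- by rewrite (lt_le_trans CDe)// lee_fin.
Qed.

Lemma almost_subC (e : R) A B : almost_sub e A B -> almost_sub e (~` B) (~` A).
Proof.
move=> [C [D [FC FD AD CB CDe]]]; exists (~` D), (~` C); split.
- exact: field_setC.
- exact: field_setC.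
- exact: subsetC.
- exact: subsetC.
- by rewrite setDE setCK setIC -setDE.
Qed.

Lemma almost_subU (e e' : R) A B A' B' : almost_sub e A B ->
  almost_sub e' A' B' -> almost_sub (e + e') (A `|` A') (B `|` B').
Proof.
move=> [C [D [FC FD AD CB CDe]]] [C' [D' [FC' FD' AD' CB' CDe']]].
exists (C `|` C'), (D `|` D'); split; try exact: field_setU.
- exact: setUSS.
- exact: setUSS.
- apply: (charge_lt_cover2 _ _ _ _ CDe CDe'); try exact: field_setD.
    by apply: (field_setD hF); exact: field_setU.
  move=> x [[Dx|Dx] /not_orP[nC nC']]; [by left|by right].
Qed.

Lemma almost_sub_set0 (e : R) A : F A -> (mu A < e%:E)%E -> almost_sub e A set0.
Proof.
move=> FA Ae; exists set0, A; rewrite setD0; split=> //.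
exact: (field_set0 hF).
Qed.

(** To pass from [A], through [B] and [A'], to [B'], what has to be paid is the
charge of the part of [B] outside [A'].  Either it is small and the two almost
inclusions compose, or a member of the field witnesses that it is large. *)
Lemma almost_sub_or_charge (e1 e2 e3 : R) A B A' B' :
  almost_sub e1 A B -> almost_sub e2 A' B' ->
  almost_sub (e1 + e3 + e2) A B' \/
  exists E, [/\ F E, E `<=` B `\` A' & (e3%:E <= mu E)%E].
Proof.
move=> [C [D [FC FD AD CB CDe]]] [C' [D' [FC' FD' AD' CB' CDe']]].
have [CDe3|] := ltP (mu (C `\` D')) e3%:E; last first.
  move=> h; right; exists (C `\` D'); split=> //; first exact: field_setD.
  by move=> x [Cx D'x]; split; [exact: CB|move/AD'].
left; exists C', D; split=> //.
have FDC := field_setD hF FD FC; have FCD' := field_setD hF FC FD'.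
have CDU := charge_lt_cover2 (field_setU hF FDC FCD') FDC FCD' (@subset_refl _ _)
  CDe CDe3.
apply: (charge_lt_cover2 _ _ _ _ CDU CDe'); try exact: field_setD.
  exact: field_setU.
move=> x [Dx C'x]; have [Cx|Cx] := pselect (C x); last by left; left.
by have [D'x|D'x] := pselect (D' x); [right|left; right].
Qed.

Lemma completionP A : pj_completion F mu A <->
  forall e : R, 0 < e -> almost_sub e A A.
Proof.
split=> h e /h[B [C]] [].
  by move=> *; exists B, C; split.
by move=> *; exists B, C; split.
Qed.

Lemma completion_sub A : F A -> pj_completion F mu A.
Proof.
by move=> FA e e0; exists A, A; split=> //; rewrite setDv charge_set0 lte_fin.
Qed.

Lemma completion_field : is_field_of_sets (pj_completion F mu).
Proof.
have pjC A : pj_completion F mu A -> pj_completion F mu (~` A).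
  by move=> /completionP h; apply/completionP => e /h/almost_subC.
have pjU A B : pj_completion F mu A -> pj_completion F mu B ->
    pj_completion F mu (A `|` B).
  move=> /completionP hA /completionP hB; apply/completionP => e e0.
  by rewrite (splitr e); apply: almost_subU; [apply: hA|apply: hB];
    rewrite divr_gt0.
split; last exact: (completion_sub (field_setT hF)).
split=> //; first exact: (completion_sub (field_set0 hF)).
move=> A B hA hB; rewrite setDE -(setCK A) -setCU.
by apply/pjC/pjU => //; exact: pjC.
Qed.

Lemma outer_chargeP (A : set X) (e : \bar R) :
  (outer_charge F mu A < e)%E <-> exists B, [/\ F B, A `<=` B & (mu B < e)%E].
Proof.
split=> [/ereal_inf_lt[_ [B [FB AB] <-] Be]|[B [FB AB Be]]]; first by exists B.
by apply: le_lt_trans Be; apply: ereal_inf_lbound; exists B.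
Qed.

Lemma outer_charge_ge0 A : (0 <= outer_charge F mu A)%E.
Proof. by apply: le_ereal_inf_tmp => _ [B [FB _] <-]; exact: charge_ge0. Qed.

(** The same [e] may bound the deviation and the charge, because the deviation set
decreases when its threshold grows. *)
Lemma hazilyP s f : converges_hazily F mu s f <->
  forall e : R, 0 < e -> \forall i \near \oo,
    exists B, [/\ F B, [set x | e < `|s i x - f x|] `<=` B & (mu B < e%:E)%E].
Proof.
split=> [h e e0|h e e0].
  have n0 : nbhs 0%E [set t : \bar R | (t < e%:E)%E].
    exists e => //= r /=; rewrite sub0r normrN lte_fin.
    by apply: le_lt_trans; exact: ler_norm.
  have := h e e0 _ n0; rewrite nbhs_simpl /=.
  by apply: filterS => i oi; apply/outer_chargeP.
move=> A [r /= r0 rA].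
have d0 : 0 < Num.min e r by rewrite lt_min e0.
suff : \forall i \near \oo, A (outer_charge F mu [set x | e < `|s i x - f x|]).
  by [].
apply: filterS (h _ d0) => i [B [FB sB Bd]].
have Bfin : mu B \is a fin_num.
  by rewrite ge0_fin_numE ?charge_ge0// (lt_trans Bd) ?ltry.
have oB : (outer_charge F mu [set x | (e < `|s i x - f x|)%R] <= mu B)%E.
  apply: ereal_inf_lbound; exists B => //; split=> // x /= ex; apply: sB => /=.
  by rewrite (le_lt_trans _ ex)// ge_min lexx.
have ofin : outer_charge F mu [set x | e < `|s i x - f x|] \is a fin_num.
  rewrite ge0_fin_numE ?outer_charge_ge0// (le_lt_trans oB)//.
  by rewrite (lt_trans Bd)// ltry.
rewrite /= -(fineK ofin); apply: rA => /=.
rewrite sub0r normrN ger0_norm ?fine_ge0 ?outer_charge_ge0//.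
rewrite -lte_fin fineK// (le_lt_trans oB)// (lt_le_trans Bd)// lee_fin.
by rewrite ge_min lexx orbT.
Qed.

End ChargeSpace.

(** * Dense subsets of the real line *)

Section Dense.
Context (R : realType).
Implicit Types (D : set R).

Lemma dense_itv D a b : dense D -> a < b -> exists2 y, D y & a < y < b.
Proof.
move=> dD ab; have [||y [/= +]] := dD `]a, b[%classic.
- by exists ((a + b) / 2); rewrite /= in_itv/=; apply/andP; split; lra.
- exact: interval_open.
- by rewrite in_itv/= => yab Dy; exists y.
Qed.

Lemma itv_dense D :
  (forall a b : R, a < b -> exists2 y, D y & a < y < b) -> dense D.
Proof.
move=> h O [z Oz] oO.
have [e /= e0 eO] : nbhs z O by exact: open_nbhs_nbhs.
have [|y Dy yze] := h (z - e) (z + e); first lra.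
exists y; split=> //; apply: eO => /=.
by rewrite /ball_/= ltr_distl; lra.
Qed.

Lemma dense_scale D (q : R) : q != 0 -> dense D ->
  dense [set d | D (q * d)].
Proof.
move=> q0 dD; apply: itv_dense => a b ab.
have [qp|qn] := ltP 0 q.
  have [|y Dy] := @dense_itv D (q * a) (q * b) dD; first by rewrite ltr_pM2l.
  move=> /andP[ay yb]; exists (y / q); first by rewrite /= mulrCA divff// mulr1.
  by rewrite ltr_pdivlMr// ltr_pdivrMr// !(mulrC _ q) ay.
have {}qn : q < 0 by rewrite lt_neqAle q0.
have [|y Dy] := @dense_itv D (q * b) (q * a) dD; first by rewrite ltr_nM2l.
move=> /andP[ay yb]; exists (y / q); first by rewrite /= mulrCA divff// mulr1.
by rewrite ltr_ndivlMr// ltr_ndivrMr// !(mulrC _ q) ay yb.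
Qed.

Lemma open_scale D (q : R) : open D -> open [set d | D (q * d)].
Proof.
move=> oD; apply: (@open_comp _ _ (fun d => q * d)) => // x _.
exact: mulrl_continuous.
Qed.

End Dense.

(** * Separated rays and points of small jump *)

Section Rays.
Context (R : realType) (X : Type) (f : X -> R).

Lemma preimage_ray_gt y : f @^-1` `]y, +oo[ = [set x | y < f x].
Proof. by apply/seteqP; split=> x /=; rewrite in_itv/= andbT. Qed.

Lemma preimage_ray_lt y : f @^-1` `]-oo, y[ = [set x | f x < y].
Proof. by apply/seteqP; split=> x /=; rewrite in_itv. Qed.

End Rays.

Section SmallJumps.
Context (R : realType) (X : Type) (F : set (set X)) (mu : set X -> \bar R).
Context (hF : is_field_of_sets F) (hmu : is_charge F mu).
Implicit Types (f : X -> R).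

Definition ray_separated f := forall b a e : R, b < a -> 0 < e ->
  almost_sub F mu e [set x | a < f x] [set x | b < f x].

(** For measurable rays this means that [{y1 < f < y2}] has charge less than [e];
with almost inclusion, measurability is part of what is asserted. *)
Definition small_jump f (e : R) : set R := [set y | exists y1 y2 : R,
  y1 < y < y2 /\ almost_sub F mu e [set x | y1 < f x] [set x | y2 <= f x]].

Definition continuity_point f (y : R) := forall e : R, 0 < e -> small_jump f e y.

Lemma continuity_point_gt f y : continuity_point f y ->
  pj_completion F mu [set x | y < f x].
Proof.
move=> fy; apply/completionP => e /fy[y1 [y2 [/andP[y1y yy2]]]].
apply: almost_sub_mono => // x /=; first exact: (lt_trans y1y).
exact: (lt_le_trans yy2).
Qed.

Lemma continuity_point_lt f y : continuity_point f y ->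
  pj_completion F mu [set x | f x < y].
Proof.
move=> fy; have -> : [set x | f x < y] = ~` [set x | y <= f x].
  by apply/seteqP; split=> x /=; rewrite ltNge => /negP.
apply: (field_setC (completion_field hF hmu)).
apply/completionP => e /fy[y1 [y2 [/andP[y1y yy2]]]].
apply: almost_sub_mono => // x /=; first exact: (lt_le_trans y1y).
exact: (le_trans (ltW yy2)).
Qed.

Lemma small_jump_open f e : open (small_jump f e).
Proof.
rewrite openE => y [y1 [y2 [y12 fe]]].
have /filterS : nbhs y `]y1, y2[%classic.
  by apply: open_nbhs_nbhs; split; [exact: interval_open|rewrite /= in_itv].
by apply=> z /=; rewrite in_itv/= => zy; exists y1, y2.
Qed.

(** The inner charge of the preimage of [`]z - d, z + d[] decreases with [d], so the
limit is an infimum and its finiteness is witnessed by one radius. *)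
Lemma boundary_mass_limit_fin f z : (boundary_mass_limit F mu f z < +oo)%E ->
  exists2 d : R, 0 < d &
    (inner_charge F mu (f @^-1` `](z - d)%R, (z + d)%R[) < +oo)%E.
Proof.
have mono : {in `]0, 1[ &, {homo
    (fun d => inner_charge F mu (f @^-1` `](z - d)%R, (z + d)%R[)) :
    d d' / d <= d' >-> (d <= d')%E}}.
  move=> d d' _ _ dd'; apply: le_ereal_sup => _ [B [FB Bd] <-].
  exists B => //; split=> // x /Bd /=; rewrite !in_itv/= => /andP[zx xz].
  by apply/andP; split; lra.
rewrite /boundary_mass_limit.
have /(_ _)/cvg_lim -> // := nondecreasing_at_right_cvge (BLeft 1) _ mono.
  move=> /ereal_inf_lt[_ [d +] <- dz]; rewrite /= in_itv/= => /andP[d0 _].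
  by exists d.
by rewrite bnd_simp.
Qed.

(** If no point of [`]c, d[] has a small jump, then every subinterval already carries
charge [e / 3]: four levels inside it give two almost inclusions of error
[e / 3], whose composition would be a small jump if the charge between them
were less than [e / 3].  Keeping one half of the interval for this and the other
half for the induction gives disjoint sets and any multiple of [e / 3]. *)
Lemma charge_ge_without_small_jump f (e c d : R) : ray_separated f -> 0 < e -> c < d ->
  (forall y, small_jump f e y -> ~ (c < y < d)) ->
  forall n, exists E, [/\ F E, E `<=` [set x | c < f x < d] &
                      ((n%:R * (e / 3))%:E <= mu E)%E].
Proof.
move=> sep e0 + + n; elim: n c d => [|n IH] c d cd nojump.
  exists set0; split=> //; first exact: field_set0.
  by rewrite mul0r (charge_set0 hmu).
pose m := (c + d) / 2.
have [||E [FE Ecm nE]] := IH c m.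
- by rewrite /m; lra.
- move=> y /nojump yd /andP[cy ym]; apply: yd; rewrite cy /=.
  by rewrite /m in ym; lra.
(* [E] lies over the lower half [`]c, m[]; the four new levels are taken in the
   upper half [`]m, d[], so that [E'] is disjoint from [E]. *)
pose t (k : R) := m + k * (d - m) / 5.
have e30 : 0 < e / 3 by rewrite divr_gt0.
have md : m < d by rewrite /m; lra.
have cm : c < m by rewrite /m; lra.
have t21 : t 1 < t 2 by rewrite /t; lra.
have t43 : t 3 < t 4 by rewrite /t; lra.
have [jump|[E' [FE' E'md eE']]] :=
    almost_sub_or_charge hF hmu (e / 3) (sep _ _ _ t21 e30) (sep _ _ _ t43 e30).
  exfalso; apply: (nojump ((t 2 + t 3) / 2)); last by rewrite /t; lra.
  exists (t 2), (t 3); split; first by rewrite /t; lra.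
  by apply: almost_sub_mono jump => //; [lra|move=> x /=; exact: ltW].
have disj : E `&` E' = set0.
  apply/seteqP; split=> // x [/Ecm/= /andP[_ xm] /E'md[/= + _]].
  by rewrite /t; lra.
exists (E `|` E'); split; first exact: field_setU.
  move=> x [/Ecm|/E'md[]] /=; first by case/andP=> -> /=; lra.
  by move=> + /negP; rewrite -leNgt /t; lra.
rewrite (charge_disjointU hmu)// -natr1 mulrDl mul1r EFinD; exact: leeD.
Qed.

(** Near any point there is an interval whose preimage has finite inner charge;
by [charge_ge_without_small_jump] it cannot be free of small jumps. *)
Lemma small_jump_dense f (e : R) : ray_separated f ->
  dense (boundary_mass_limit F mu f @^-1` [set t : \bar R | (0 <= t < +oo)%E]) ->
  0 < e -> dense (small_jump f e).
Proof.
move=> sep phi e0; apply: itv_dense => a b ab.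
have [z /= /andP[_ /boundary_mass_limit_fin[d d0 zfin]] zab] := dense_itv phi ab.
apply: contrapT => nojump.
pose c1 := Num.max a (z - d); pose c2 := Num.min b (z + d).
have c12 : c1 < c2.
  by rewrite /c1 /c2 lt_min !gt_max; lra.
have := charge_ge_without_small_jump sep e0 c12.
have /[swap]/[apply] : forall y, small_jump f e y -> ~ c1 < y < c2.
  move=> y jy; rewrite /c1 /c2 lt_min gt_max => /andP[/andP[ay _] /andP[yb _]].
  by apply: nojump; exists y; rewrite ?ay.
move=> acc.
have Iub n : ((n%:R * (e / 3))%:E <=
    inner_charge F mu (f @^-1` `](z - d)%R, (z + d)%R[))%E.
  have [E [FE Ec nE]] := acc n; apply: le_trans nE _.
  apply: ereal_sup_ubound; exists E => //; split=> // x /Ec /=.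
  by rewrite in_itv/= /c1 /c2 lt_min gt_max; lra.
have Ifin : inner_charge F mu (f @^-1` `](z - d)%R, (z + d)%R[) \is a fin_num.
  by rewrite ge0_fin_numE// (le_trans _ (Iub 0%N))// mul0r.
set I := inner_charge _ _ _ in Iub Ifin.
have := Iub (Num.truncn (fine I / (e / 3))).+1.
rewrite -(fineK Ifin) lee_fin -ler_pdivlMr ?divr_gt0//.
by rewrite leNgt truncnS_gt.
Qed.

(** A point is a continuity point when it has a small jump for every [1 / m], and
[d |-> q t * d] pulls back dense open sets to dense open sets as [q t != 0].
Hence the set in question is a countable intersection of dense open sets. *)
Lemma continuity_points_comeager (T : countType) (q : T -> R) f :
  ray_separated f ->
  dense (boundary_mass_limit F mu f @^-1` [set t : \bar R | (0 <= t < +oo)%E]) ->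
  (forall t, q t != 0) ->
  dense [set d | forall t, continuity_point f (q t * d)].
Proof.
move=> sep phi q0.
pose A (n : nat) : set R := if unpickle n is Some (t, m) then
  [set d | small_jump f m.+1%:R^-1 (q t * d)] else setT.
have : dense (\bigcap_n A n).
  apply: Baire => n; rewrite /A; case: unpickle => [[t m]|].
    split; first exact/open_scale/small_jump_open.
    by apply: dense_scale => //; apply: small_jump_dense => //; rewrite invr_gt0.
  by split; [exact: openT|move=> O [z Oz] _; exists z].
suff AD : \bigcap_n A n `<=` [set d | forall t, continuity_point f (q t * d)].
  move=> dA O O0 oO; have [d [Od Ad]] := dA O O0 oO.
  by exists d; split=> //; exact: AD.
move=> d Ad t e e0.
have := Ad (pickle (t, Num.truncn e^-1)) I; rewrite /A pickleK /=.
move=> [y1 [y2 [y12 je]]]; exists y1, y2; split=> //.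
apply: almost_sub_mono je => //.
rewrite -[leRHS]invrK lef_pV2 ?posrE ?invr_gt0//.
exact/ltW/truncnS_gt.
Qed.

End SmallJumps.

(** * From the measurability conditions to separated rays and back *)

(** The sets containing a given member of [W] generate a filter, as [W] is closed
under unions; near-covering along this filter replaces the extraction of
a finite subcover. *)
Lemma compact_directed_cover (T : topologicalType) (K : set T)
    (W : set (set T)) : compact K -> W set0 -> setU_closed W ->
  (forall x, K x -> exists2 V, W V & nbhs x V) -> exists2 V, W V & K `<=` V.
Proof.
move=> /compact_near_coveringP cK W0 WU Wx.
pose Wfilter : set_system (set T) := [set P | exists2 V0, W V0 &
  forall V, W V -> V0 `<=` V -> P V].
have Wfil : Filter Wfilter.
  split; first by exists set0.
    move=> P Q [V WV VP] [V' WV' VQ]; exists (V `|` V'); first exact: WU.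
    move=> U WUU; rewrite subUset => -[VU V'U].
    by split; [exact: VP|exact: VQ].
  by move=> P Q PQ [V WV VP]; exists V => // U WUU VU; apply/PQ/VP.
have [x Kx|V WV KV] := cK _ Wfilter (fun V x => V x) Wfil.
  have [V WV Vx] := Wx x Kx.
  exists (V, [set U | V `<=` U]); first by split=> //; exists V.
  by move=> [y U] [/= Vy]; exact.
by exists V => //; exact: KV.
Qed.

Section Measurability.
Context (R : realType) (X : Type) (F : set (set X)) (mu : set X -> \bar R).
Context (hF : is_field_of_sets F) (hmu : is_charge F mu).
Implicit Types (f : X -> R).

Let Fbar := pj_completion F mu.
Let hFbar : is_field_of_sets Fbar := completion_field hF hmu.

Lemma base_measurable_segment f (p q : R) (U : set R) : base_measurable F mu f ->
  open U -> `[p, q] `<=` U ->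
  exists V, [/\ Fbar (f @^-1` V), `[p, q] `<=` V & V `<=` U].
Proof.
move=> bf oU pqU.
have [|A B|y pqy|V [FV VU] pqV] := @compact_directed_cover R `[p, q]
    [set V | Fbar (f @^-1` V) /\ V `<=` U] (@segment_compact R p q).
- by split=> //; exact: (field_set0 hFbar).
- move=> [FA AU] [FB BU]; split; last by rewrite subUset.
  exact: (field_setU hFbar).
- have [B [By Bbase] FB] := bf y.
  have [V BV VU] := Bbase U (open_nbhs_nbhs (conj oU (pqU _ pqy))).
  by exists V; [split; first exact: FB|exact: By].
by exists V.
Qed.

Lemma ray_separated_completion f :
  (forall b a, b < a -> exists2 H, Fbar H &
     [set x | a < f x] `<=` H /\ H `<=` [set x | b < f x]) ->
  ray_separated F mu f.
Proof.
move=> h b a e ba e0; have [H /completionP FH [aH Hb]] := h b a ba.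
exact: almost_sub_mono (FH e e0).
Qed.

Lemma left_ray_measurable_separated f :
  left_ray_measurable F mu f -> ray_separated F mu f.
Proof.
move=> [D [dD FD]]; apply: ray_separated_completion => b a ba.
have [y Dy /andP[bY ya]] := dense_itv dD ba.
exists (~` [set x | f x < y]).
  by apply: (field_setC hFbar); rewrite -preimage_ray_lt; exact: FD.
split=> x /=; first by move=> ax /lt_trans/(_ ya); rewrite ltNge (ltW ax).
by move=> /negP; rewrite -leNgt; exact: lt_le_trans.
Qed.

(** The parts [f^\+] and [f^\-] see only positive levels.  When [b] and [a] have
opposite signs, a pair of levels of the same sign lies between them; the negative
levels are handled by passing to complements. *)
Lemma ray_separated_pos_neg f :
  (forall b a e : R, 0 < b -> b < a -> 0 < e ->
    almost_sub F mu e [set x | a < f^\+ x] [set x | b < f^\+ x]) ->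
  (forall b a e : R, 0 < b -> b < a -> 0 < e ->
    almost_sub F mu e [set x | a < f^\- x] [set x | b < f^\- x]) ->
  ray_separated F mu f.
Proof.
move=> fp fn b a e ba e0; have [a0|a0] := ltP 0 a.
  have b'a : Num.max b (a / 2) < a by rewrite gt_max ba/=; lra.
  have b'0 : 0 < Num.max b (a / 2) by rewrite lt_max; apply/orP; right; lra.
  apply: almost_sub_mono (fp _ _ _ b'0 b'a e0) => // x /=.
    by rewrite /funrpos lt_max => ->.
  by rewrite /funrpos lt_max !gt_max; lra.
have b12 : - ((b + 2 * a) / 3) < - ((2 * b + a) / 3) by lra.
have b20 : 0 < - ((b + 2 * a) / 3) by lra.
apply: almost_sub_mono (almost_subC hF (fn _ _ _ b20 b12 e0)) => // x /=.
  by move=> ax; apply/negP; rewrite /funrneg lt_max; lra.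
by move=> /negP; rewrite /funrneg lt_max; lra.
Qed.

Lemma completion_measurable_separated f :
  completion_measurable F mu f -> ray_separated F mu f.
Proof.
move=> cf; apply: ray_separated_pos_neg => b a e b0 ba e0.
  have [|H /completionP FH] := cf f^\+ _ a b (lt_trans b0 ba) b0 ba; first by left.
  rewrite !preimage_ray_gt => -[aH Hb]; exact: almost_sub_mono (FH e e0).
have [|H /completionP FH] := cf f^\- _ a b (lt_trans b0 ba) b0 ba; first by right.
rewrite !preimage_ray_gt => -[aH Hb]; exact: almost_sub_mono (FH e e0).
Qed.

(** Some measurable ray is needed as an anchor: preimages of small sets alone
give no information on [{f > b}].  The segment between the anchor [y] and the
level to be separated is compact, and the set covering it is added to or removed
from the anchor ray. *)
Lemma base_measurable_separated f (y : R) : base_measurable F mu f ->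
  Fbar [set x | y < f x] -> ray_separated F mu f.
Proof.
move=> bf Fy; apply: ray_separated_completion => b a ba.
have [yb|yb] := ltP b y.
  have [||V [FV ayV Vb]] := @base_measurable_segment f a y `]b, +oo[%classic bf.
  - exact: interval_open.
  - by move=> z /=; rewrite !in_itv/= andbT => /andP[/(lt_le_trans ba)].
  exists ((f @^-1` V) `|` [set x | y < f x]); first exact: (field_setU hFbar).
  split=> x /=.
    move=> ax; have [fy|] := leP (f x) y; last by right.
    by left; apply: ayV; rewrite /= in_itv/= (ltW ax).
  by move=> [/Vb/=|/(lt_trans yb)//]; rewrite in_itv/= andbT.
have [||V [FV ybV Va]] := @base_measurable_segment f y b `]-oo, a[%classic bf.
- exact: interval_open.
- by move=> z /=; rewrite !in_itv/= => /andP[_ /le_lt_trans]; exact.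
exists ([set x | y < f x] `\` (f @^-1` V)); first exact: (field_setD hFbar).
split=> x /=.
  move=> ax; split; first by rewrite (le_lt_trans yb)// (lt_trans ba).
  by move=> /Va/=; rewrite in_itv/= ltNge (ltW ax).
move=> [yx nV]; rewrite ltNge; apply/negP => fb; apply: nV; apply: ybV.
by rewrite /= in_itv/= (ltW yx).
Qed.

(** A nonnegative function has the whole space as anchor ray, at level [-1]. *)
Lemma base_measurable_pos_neg_separated f :
  base_measurable F mu f^\+ -> base_measurable F mu f^\- ->
  ray_separated F mu f.
Proof.
move=> bp bn.
have sep g : (forall x, 0 <= g x) -> base_measurable F mu g ->
    ray_separated F mu g.
  move=> g0 bg; apply: (@base_measurable_separated _ (-1) bg).
  have -> : [set x | -1 < g x] = setT.
    by apply/seteqP; split=> // x _ /=; rewrite (lt_le_trans _ (g0 x))//; lra.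
  exact: (field_setT hFbar).
apply: ray_separated_pos_neg => b a e _ ba e0.
  by apply: sep => // x; rewrite /funrpos le_max lexx orbT.
by apply: sep => // x; rewrite /funrneg le_max lexx orbT.
Qed.

(** Smoothness takes the place of the anchor ray: the part of [{f > a}] beyond the compact
segment [`[a, k]] is covered by a set of charge less than [e / 2]. *)
Lemma smooth_base_measurable_separated f :
  base_measurable F mu f -> smooth F mu f -> ray_separated F mu f.
Proof.
move=> bf sf b a e ba e0; have e20 : 0 < e / 2 by lra.
have [k k0 /outer_chargeP[C [FC kC Ce]]] := sf _ e20.
have [||V [/completionP FV akV Vb]] :=
    @base_measurable_segment f a k `]b, +oo[%classic bf.
- exact: interval_open.
- by move=> z /=; rewrite !in_itv/= andbT => /andP[/(lt_le_trans ba)].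
have := almost_subU hF hmu (FV _ e20) (almost_sub_set0 hF FC Ce).
apply: almost_sub_mono; first by lra.
  move=> x /= ax; have [xk|kx] := leP (f x) k.
    by left; apply: akV; rewrite /= in_itv/= (ltW ax).
  by right; apply: kC; rewrite /= (lt_le_trans kx)// ler_norm.
by rewrite setU0 => x /Vb/=; rewrite in_itv/= andbT.
Qed.

Lemma ray_measurable_base f : ray_measurable F mu f -> base_measurable F mu f.
Proof.
move=> [D [dD FD]] y.
exists [set V | exists y1 y2, [/\ D y1, D y2, y1 < y < y2 & V = `]y1, y2[%classic]].
  split=> [V [y1 [y2 [Dy1 Dy2 y12 ->]]]|U [e /= e0 eU]].
    by apply: open_nbhs_nbhs; split; [exact: interval_open|rewrite /= in_itv].
  have [|y1 Dy1 y1e] := @dense_itv R D (y - e) y dD; first by lra.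
  have [|y2 Dy2 y2e] := @dense_itv R D y (y + e) dD; first by lra.
  exists `]y1, y2[%classic; first by exists y1, y2; split=> //; lra.
  move=> z /=; rewrite in_itv/= => yz; apply: eU.
  by rewrite /ball_/= ltr_distlC; lra.
move=> V [y1 [y2 [Dy1 Dy2 y12 ->]]].
have -> : f @^-1` `]y1, y2[ = f @^-1` `]y1, +oo[ `&` f @^-1` `]-oo, y2[.
  rewrite preimage_ray_gt preimage_ray_lt.
  by apply/seteqP; split=> x /=; rewrite in_itv/= => /andP.
by apply: (field_setI hFbar); [have [] := FD _ Dy1|have [] := FD _ Dy2].
Qed.

Lemma ray_measurable_pos f : ray_measurable F mu f -> ray_measurable F mu f^\+.
Proof.
move=> [D [dD FD]]; exists D; split=> // y /FD[].
rewrite !preimage_ray_gt !preimage_ray_lt => Fgt Flt; split.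
  have [y0|y0] := ltP y 0.
    have -> : [set x | y < f^\+ x] = setT.
      by apply/seteqP; split=> // x _ /=; rewrite /funrpos lt_max y0 orbT.
    exact: (field_setT hFbar).
  have -> // : [set x | y < f^\+ x] = [set x | y < f x].
  by apply/seteqP; split=> x /=; rewrite /funrpos lt_max [y < 0]ltNge y0 orbF.
have [y0|y0] := ltP 0 y.
  have -> // : [set x | f^\+ x < y] = [set x | f x < y].
  by apply/seteqP; split=> x /=; rewrite /funrpos gt_max y0 andbT.
have -> : [set x | f^\+ x < y] = set0.
  by apply/seteqP; split=> // x /=; rewrite /funrpos gt_max [0 < y]ltNge y0 andbF.
exact: (field_set0 hFbar).
Qed.

Lemma ray_measurable_opp f : ray_measurable F mu f -> ray_measurable F mu (\- f).
Proof.
move=> [D [dD FD]]; exists [set y | D (- y)]; split.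
  have := @dense_scale R D (-1); rewrite oppr_eq0 oner_eq0 => /(_ isT dD).
  by under eq_set do rewrite mulN1r.
move=> y /FD[]; rewrite !preimage_ray_gt !preimage_ray_lt => Fgt Flt; split.
  have -> // : [set x | y < - f x] = [set x | f x < - y].
  by apply/seteqP; split=> x /=; lra.
have -> // : [set x | - f x < y] = [set x | - y < f x].
by apply/seteqP; split=> x /=; lra.
Qed.

Lemma ray_separated_ray_measurable f : ray_separated F mu f ->
  dense (boundary_mass_limit F mu f @^-1` [set t : \bar R | (0 <= t < +oo)%E]) ->
  ray_measurable F mu f.
Proof.
move=> sep phi.
have := @continuity_points_comeager _ _ _ _ hF hmu unit (fun=> 1) f sep phi.
move=> /(_ (fun=> oner_neq0 _)) dD; eexists; split; first exact: dD.
move=> y /(_ tt); rewrite mul1r preimage_ray_gt preimage_ray_lt => fy.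
by split; [exact: continuity_point_gt|exact: continuity_point_lt].
Qed.

Lemma ray_measurable_left f : ray_measurable F mu f -> left_ray_measurable F mu f.
Proof. by move=> [D [dD FD]]; exists D; split=> // y /FD[]. Qed.

Lemma ray_measurable_right f :
  ray_measurable F mu f -> right_ray_measurable F mu f.
Proof. by move=> [D [dD FD]]; exists D; split=> // y /FD[]. Qed.

Lemma right_ray_measurable_completion f :
  right_ray_measurable F mu f -> completion_measurable F mu f.
Proof.
move=> [D [dD FD]] h [->|->] a b a0 b0 ba.
  have [y Dy /andP[bY ya]] := dense_itv dD ba.
  exists [set x | y < f x]; first by rewrite -preimage_ray_gt; exact: FD.
  rewrite !preimage_ray_gt; split=> x /=.
    by rewrite /funrpos lt_max; lra.
  by rewrite /funrpos lt_max => /(lt_trans bY)->.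
have [|y Dy /andP[aY yb]] := @dense_itv R D (- a) (- b) dD; first by lra.
exists (~` [set x | y < f x]).
  by apply: (field_setC hFbar); rewrite -preimage_ray_gt; exact: FD.
rewrite !preimage_ray_gt; split=> x /=.
  by rewrite /funrneg lt_max => ax; apply/negP; lra.
by move=> /negP xy; rewrite /funrneg lt_max; lra.
Qed.

End Measurability.

(** * Simple functions and dyadic sums *)

Lemma sum_indicB_closed (R : realType) (X : Type) (P : (X -> R) -> Prop)
    (c : nat -> R) (A B : nat -> set X) m n :
  (forall a, P (fun=> a)) ->
  (forall (op : R -> R -> R) g h, P g -> P h -> P (fun x => op (g x) (h x))) ->
  (forall k, (m <= k < n)%N -> P \1_(A k) /\ P \1_(B k)) ->
  P (fun x => \sum_(m <= k < n) c k * (\1_(A k) x - \1_(B k) x)).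
Proof.
move=> Pcst Pop; elim: n => [|n IH] PAB.
  by under eq_fun do rewrite big_geq//.
have [mn|nm] := leqP m n; last by under eq_fun do rewrite big_geq//.
under eq_fun do rewrite big_nat_recr//=.
have [|PA PB] := PAB n; first by rewrite mn ltnS leqnn.
apply: (Pop +%R); first by apply: IH => k /andP[mk kn]; apply: PAB; rewrite mk ltnW.
by apply: (Pop *%R (fun=> c n)) => //; exact: (Pop (fun u v => u - v)).
Qed.

Section SimpleFunctions.
Context (R : realType) (X : Type) (G : set (set X)) (hG : is_field_of_sets G).
Implicit Types (g h : X -> R).

Lemma simple_op2 (op : R -> R -> R) g h : simple_function G g ->
  simple_function G h -> simple_function G (fun x => op (g x) (h x)).
Proof.
move=> [fg Gg] [fh Gh]; split=> [|y].
  apply: sub_finite_set (finite_image2 op fg fh) => _ [x _ <-].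
  by exists (g x); [exists x|exists (h x) => //; exists x].
pose D : set (R * R) := [set p | [/\ range g p.1, range h p.2 & op p.1 p.2 = y]].
have -> : (fun x => op (g x) (h x)) @^-1` [set y] =
    \bigcup_(p in D) (g @^-1` [set p.1] `&` h @^-1` [set p.2]).
  apply/seteqP; split=> [x /= xy|x [p [_ _ py] [/= -> ->]]//].
  by exists (g x, h x) => //; split=> //=; exists x.
apply: (field_finite_bigcup hG).
  apply: sub_finite_set (finite_setX fg fh) => p [gp hp _].
  by split.
by move=> p _; apply: (field_setI hG).
Qed.

Lemma simple_cst (c : R) : simple_function G (fun=> c).
Proof.
split; first exact: finite_image_cst.
move=> y; have [->|cy] := eqVneq c y.
  have -> : (fun=> y) @^-1` [set y] = [set: X] by apply/seteqP.
  exact: (field_setT hG).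
have -> : (fun=> c) @^-1` [set y] = set0 :> set X.
  by apply/seteqP; split=> // x /= /eqP; rewrite (negbTE cy).
exact: (field_set0 hG).
Qed.

Lemma simple_indic A : G A -> simple_function G (\1_A : X -> R).
Proof.
move=> GA; split.
  apply: (@sub_finite_set _ _ [set (0 : R); 1]) => [_ [x _ <-]|].
    by rewrite indicE; case: (x \in A); [right|left].
  exact: finite_set2.
move=> y; have [->|y1] := eqVneq y 1.
  have -> // : (\1_A : X -> R) @^-1` [set 1] = A.
  apply/seteqP; split=> x /=; rewrite indicE.
    by case: (boolP (x \in A)) => [/set_mem//|_ /eqP]; rewrite eq_sym oner_eq0.
  by move=> Ax; rewrite mem_set.
have [->|y0] := eqVneq y 0.
  have -> // : (\1_A : X -> R) @^-1` [set 0] = ~` A.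
    apply/seteqP; split=> x /=; rewrite indicE.
      by move=> + Ax; rewrite mem_set// => /eqP; rewrite oner_eq0.
    by move=> Ax; rewrite memNset.
  exact: (field_setC hG).
have -> : (\1_A : X -> R) @^-1` [set y] = set0; last exact: (field_set0 hG).
apply/seteqP; split=> // x /=; rewrite indicE => xy.
by move: y1 y0; rewrite -xy; case: (x \in A); rewrite eqxx.
Qed.

End SimpleFunctions.

Section DyadicSums.
Context (R : realType).

(** The value at [u = f x] of the [i]-th function in the definition of regular
T1-measurability, for [h = 2 ^- i * delta] and [N = i * 2 ^ i]: when
[`|u| <= N%:R * h], it replaces [`|u|] by the largest multiple of [h] strictly
below, keeping the sign of [u]. *)
Definition dyadic_sum (h : R) (N : nat) (u : R) : R :=
  \sum_(1 <= k < N) k%:R * h *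
    ((k%:R * h < u <= k.+1%:R * h)%R%:R - (k%:R * h < - u <= k.+1%:R * h)%R%:R).

Lemma dyadic_sumN h N u : dyadic_sum h N (- u) = - dyadic_sum h N u.
Proof.
rewrite /dyadic_sum -sumrN; apply: eq_bigr => k _.
by rewrite opprK -mulrN opprB.
Qed.

Lemma dyadic_sum_dist_pos (h : R) N u : 0 < h -> (0 < N)%N -> 0 < u ->
  u <= N%:R * h -> `|dyadic_sum h N u - u| <= h.
Proof.
move=> h0 N0 u0 uN.
have [m [mN hmu umh]] : exists m, [/\ (m < N)%N, m%:R * h < u & u <= m.+1%:R * h].
  elim: N uN {N0} => [|N IH] uN; first by move: uN; rewrite mul0r leNgt u0.
  have [/IH[m [mN ? ?]]|Nu] := leP u (N%:R * h); last by exists N.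
  by exists m; split=> //; exact: ltnW.
have kh0 k : (k%:R * h < - u) = false.
  apply/negbTE; rewrite -leNgt (@le_trans _ _ 0)//; first by rewrite lerNl oppr0 ltW.
  by rewrite mulr_ge0// ltW.
have kh k : (k%:R * h < u <= k.+1%:R * h) = (k == m).
  apply/idP/eqP => [/andP[ku uk]|->]; last by rewrite hmu.
  have le_of (i j : nat) : i%:R * h < u -> u <= j.+1%:R * h -> (i <= j)%N.
    by move=> iu uj; rewrite -ltnS -(ltr_nat R) -(ltr_pM2r h0) (lt_le_trans iu).
  by apply/eqP; rewrite eqn_leq !le_of.
have -> : dyadic_sum h N u = m%:R * h.
  transitivity (\sum_(0 <= k < N) k%:R * h * (k == m)%:R).
    rewrite big_ltn// !mul0r add0r; apply: eq_bigr => k _.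
    by rewrite kh0 kh subr0.
  rewrite big_mkord (bigD1 (Ordinal mN))//= eqxx mulr1 big1 ?addr0// => k.
  by rewrite -val_eqE /= => /negbTE->; rewrite mulr0.
rewrite distrC ger0_norm; last lra.
by move: umh; rewrite -natr1; lra.
Qed.

Lemma dyadic_sum_dist (h : R) N u : 0 < h -> (0 < N)%N -> `|u| <= N%:R * h ->
  `|dyadic_sum h N u - u| <= h.
Proof.
move=> h0 N0; have [u0|u0|<-] := ltgtP 0 u.
- by rewrite gtr0_norm//; exact: dyadic_sum_dist_pos.
- rewrite ltr0_norm// => uN.
  have := @dyadic_sum_dist_pos h N (- u) h0 N0; rewrite oppr_gt0 => /(_ u0 uN).
  by rewrite dyadic_sumN -opprD normrN.
- move=> _; have -> : dyadic_sum h N 0 = 0.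
    by rewrite /dyadic_sum big1// => k _; rewrite oppr0 subrr mulr0.
  by rewrite subr0 normr0 ltW.
Qed.

End DyadicSums.

(** * Hazy approximation by simple functions *)

Section HazyApproximation.
Context (R : realType) (X : Type) (F : set (set X)) (mu : set X -> \bar R).
Context (hF : is_field_of_sets F) (hmu : is_charge F mu).
Implicit Types (f g h : X -> R).

Let Fbar := pj_completion F mu.
Let hFbar : is_field_of_sets Fbar := completion_field hF hmu.

Definition nearly_simple h := forall e : R, 0 < e -> exists g E,
  [/\ simple_function F g, F E, (mu E < e%:E)%E & forall x, ~ E x -> g x = h x].

Lemma nearly_simple_op2 (op : R -> R -> R) g h :
  nearly_simple g -> nearly_simple h -> nearly_simple (fun x => op (g x) (h x)).
Proof.
move=> ng nh e e0; have e20 : 0 < e / 2 by lra.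
have [g' [A [sg FA Ae gE]]] := ng _ e20.
have [h' [B [sh FB Be hE]]] := nh _ e20.
exists (fun x => op (g' x) (h' x)), (A `|` B); split.
- exact: simple_op2.
- exact: field_setU.
- rewrite (splitr e).
  exact: (charge_lt_cover2 hF hmu (field_setU hF FA FB) FA FB (@subset_refl _ _)).
- by move=> x /not_orP[nA nB]; rewrite gE// hE.
Qed.

Lemma nearly_simple_cst (c : R) : nearly_simple (fun=> c).
Proof.
move=> e e0; exists (fun=> c), set0; split=> //.
- exact: simple_cst.
- exact: field_set0.
- by rewrite (charge_set0 hmu) lte_fin.
Qed.

Lemma nearly_simple_indic A : Fbar A -> nearly_simple (\1_A).
Proof.
move=> FA e /FA[B [C [FB FC BA AC Ce]]]; exists (\1_B), (C `\` B); split=> //.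
- exact: simple_indic.
- exact: (field_setD hF).
move=> x /= nCB; rewrite !indicE; congr (_%:R); congr nat_of_bool.
apply/idP/idP => /set_mem => [/BA|/AC Cx]; first exact: mem_set.
by apply/mem_set; apply: contrapT => nB; exact: nCB.
Qed.

(** The sets in the definition of [s i] are only in the completion.  Replacing them
by members of the field changes [s i] on a set of charge less than [1 / (i + 1)],
which does not affect hazy convergence. *)
Lemma regularly_T1_T1 f :
  regularly_T1_measurable F mu f -> T1_measurable F mu f.
Proof.
move=> [s [_ sf [delta d0 sE]]].
have ns i : (1 <= i)%N -> nearly_simple (s i).
  move=> /sE[Fk sumE].
  rewrite (_ : s i = fun x => \sum_(1 <= k < (i * 2 ^ i - 1).+1)
      dyadic_level delta i k * (\1_(dyadic_pos_part f delta i k) x -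
        \1_(dyadic_neg_part f delta i k) x)); last exact/funext.
  apply: sum_indicB_closed nearly_simple_cst nearly_simple_op2 _ => k.
  by rewrite ltnS => /Fk[Fp Fn]; split; exact: nearly_simple_indic.
have /choice[t tP] : forall i, exists g : X -> R, simple_function F g /\
    ((1 <= i)%N -> exists E, [/\ F E, (mu E < i.+1%:R^-1%:E)%E &
      forall x, ~ E x -> g x = s i x]).
  move=> [|i]; first by exists (fun=> 0); split=> //; exact: simple_cst.
  have i0 : 0 < i.+2%:R^-1 :> R by rewrite invr_gt0.
  have [g [E [sg FE Ee gE]]] := ns i.+1 isT _ i0.
  by exists g; split=> // _; exists E.
exists t => [i|]; first by have [] := tP i.
apply/(hazilyP hmu) => e e0; have e20 : 0 < e / 2 by lra.
have sfe := (hazilyP hmu s f).1 sf _ e20.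
near=> i.
have [B [FB sB Be]] : exists B, [/\ F B, [set x | e / 2 < `|s i x - f x|] `<=` B &
    (mu B < (e / 2)%:E)%E] by near: i; exact: sfe.
have i1 : (1 <= i)%N by near: i; exact: nbhs_infty_ge.
have ie : i.+1%:R^-1 < e / 2 by near: i; exact: (near_infty_natSinv_lt (PosNum e20)).
have [_ /(_ i1)[E [FE Ee tE]]] := tP i.
exists (B `|` E); split; first exact: field_setU.
  move=> x /= ex; have [Ex|nE] := pselect (E x); [by right|left; apply: sB].
  by rewrite /= -(tE _ nE); lra.
rewrite (splitr e).
have FBE := field_setU hF FB FE.
apply: (charge_lt_cover2 hF hmu FBE FB FE (@subset_refl _ _)) => //.
by rewrite (lt_trans Ee)// lte_fin.
Unshelve. all: by end_near. Qed.

(** Take a simple [s i] with [`|s i x - f x| <= e / 3] off a set [B] of charge less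
than [e / 3]; the blocks are [B] and the level sets of [s i] outside of [B]. *)
Lemma T1_T2 f : T1_measurable F mu f -> T2_measurable F mu f.
Proof.
move=> [s ss sf] e e0; have e30 : 0 < e / 3 by lra.
have [i _ /(_ _ (leqnn i))[B [FB sB Be]]] := (hazilyP hmu s f).1 sf _ e30.
have [/finite_seqP[r0 rE] Fs] := ss i.
pose r := undup r0.
have rP x : s i x \in r.
  have : range (s i) (s i x) by exists x.
  by rewrite rE mem_undup.
pose A (j : nat) := if j is k.+1 then s i @^-1` [set nth 0 r k] `\` B else B.
exists (size r), A; split.
- by move=> [|j] _ //=; apply: (field_setD hF).
- move=> [|j] [|k] //= js ks [x []] //=.
  + by move=> Bx [].
  + by move=> [].
  + move=> [sj _] [sk _]; congr S; apply/eqP.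
    by rewrite -(@nth_uniq _ 0 r) ?undup_uniq// -sj sk.
- apply/seteqP; split=> // x _; have [Bx|nB] := pselect (B x).
    by exists 0%N.
  exists (index (s i x) r).+1; first by rewrite /= ltnS index_mem.
  by split=> //=; rewrite nth_index.
- by rewrite (lt_trans Be)// lte_fin; lra.
- have dist x : ~ B x -> `|s i x - f x| <= e / 3.
    by move=> nB; rewrite leNgt; apply/negP => ex; apply: nB; exact: sB.
  move=> [|j] // _ x x' [/= sx /dist] + [/= sx' /dist].
  by rewrite sx sx' !ler_distl ltr_distl; lra.
Qed.

(** An oscillation bound on each of finitely many blocks makes [f] bounded on their
union, so that [`|f|] is large only on the block of small charge. *)
Lemma T2_smooth f : T2_measurable F mu f -> smooth F mu f.
Proof.
move=> T2 e e0; have [n [A [FA _ covA A0 osc]]] := T2 e e0.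
have [k k0 kP] : exists2 k : R, 0 < k &
    forall j, (1 <= j <= n)%N -> forall x, A j x -> `|f x| <= k.
  suff : forall m, exists2 k : R, 0 < k &
      forall j, (j < m)%N -> (1 <= j <= n)%N -> forall x, A j x -> `|f x| <= k.
    move=> /(_ n.+1)[k k0 kP]; exists k => // j jn.
    by apply: kP => //; case/andP: jn.
  elim=> [|m [k k0 kP]]; first by exists 1.
  have [[x0 [mn Ax0]]|nA] := pselect (exists x0, (1 <= m <= n)%N /\ A m x0).
    exists (Num.max k (`|f x0| + e)); first by rewrite lt_max k0.
    move=> j; rewrite ltnS leq_eqVlt => /predU1P[->|jm] jn x Ajx.
      have := osc m mn x x0 Ajx Ax0; rewrite ltr_distl => xx0.
      have := ler_norm (f x0); have := ler_norm (- f x0); rewrite normrN => ? ?.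
      by rewrite le_max; apply/orP; right; rewrite ler_norml; lra.
    by rewrite le_max (kP j jm jn x Ajx).
  exists k => // j; rewrite ltnS leq_eqVlt => /predU1P[->|jm] jn x Ajx.
    by exfalso; apply: nA; exists x.
  exact: kP jn x Ajx.
exists k => //; apply/outer_chargeP; exists (A 0%N); split=> //; first exact: FA.
move=> x /= kx; have : [set: X] x by [].
rewrite -covA => -[[//|j] /= jn Ajx].
by move: kx; rewrite ltNge (kP j.+1 _ x Ajx).
Qed.

(** With oscillation less than [a - b], a block meeting [{f > a}] lies in
[{f > b}].  The union [B] of these blocks covers [{f > a}] up to the block of
small charge. *)
Lemma T2_separated f : T2_measurable F mu f -> ray_separated F mu f.
Proof.
move=> T2 b a e ba e0.
have m0 : 0 < Num.min e (a - b) by rewrite lt_min e0 subr_gt0.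
have [n [A [FA _ covA A0 osc]]] := T2 _ m0.
pose B := \bigcup_(j < n.+1)
  (if `[< (0 < j)%N /\ A j `&` [set x | a < f x] !=set0 >] then A j else set0).
have FB : F B.
  apply: (field_bigcup hF) => j jn; case: asboolP => _; first exact: FA.
  exact: (field_set0 hF).
have FA0 : F (A 0%N) by exact: FA.
exists B, (B `|` A 0%N); split=> //; first exact: field_setU.
- move=> x /= ax; have : [set: X] x by [].
  rewrite -covA => -[[_ /= A0x|j /= jn Ajx]]; first by right.
  by left; exists j.+1 => //; case: asboolP => // -[]; split=> //; exists x.
- move=> x [j /= jn]; case: asboolP => // -[j0 [y [Ajy ay]]] Ajx.
  have := osc j _ x y Ajx Ajy; rewrite j0 => /(_ jn).
  rewrite lt_min => /andP[_]; rewrite ltr_distl => /andP[+ _].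
  by move: ay => /=; lra.
apply: le_lt_trans (charge_le hF hmu _ FA0 _) _.
- by apply: (field_setD hF) => //; exact: field_setU.
- by move=> x [[]].
- by rewrite (lt_le_trans A0)// lee_fin ge_min lexx.
Qed.

(** The parameter [delta] is taken such that every nonzero level of every dyadic
scale, of either sign, is a continuity point, which puts all the sets of the
definition in the completion.  The sums then differ from [f] by at most
[2 ^- i * delta] where [`|f| <= i%:R * delta]. *)
Lemma separated_smooth_regularly_T1 f : ray_separated F mu f -> smooth F mu f ->
  dense (boundary_mass_limit F mu f @^-1` [set t : \bar R | (0 <= t < +oo)%E]) ->
  regularly_T1_measurable F mu f.
Proof.
move=> sep sf phi.
(* [q (b, k, i) * delta] is the level [k.+1] of scale [i], negated if [b]. *)
pose q (t : bool * nat * nat) : R := (-1) ^+ t.1.1 * (t.1.2.+1%:R * 2 ^- t.2).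
have q0 t : q t != 0.
  by rewrite !mulf_eq0 signr_eq0 invr_eq0 expf_eq0 !pnatr_eq0 andbF.
have dD := continuity_points_comeager hF hmu sep phi q0.
have [delta cdelta /andP[d0 _]] := dense_itv dD (@ltr01 R).
have contp i k : (1 <= k)%N -> continuity_point F mu f (dyadic_level delta i k).
  by case: k => // k _; have := cdelta (false, k, i); rewrite /q expr0 mul1r.
have contn i k : (1 <= k)%N -> continuity_point F mu f (- dyadic_level delta i k).
  by case: k => // k _; have := cdelta (true, k, i); rewrite /q expr1 mulN1r mulNr.
have Fgt y : continuity_point F mu f y -> Fbar [set x | y < f x].
  exact: continuity_point_gt.
have Flt y : continuity_point F mu f y -> Fbar [set x | f x < y].
  exact: continuity_point_lt.
have Fpos i k : (1 <= k)%N -> Fbar (dyadic_pos_part f delta i k).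
  move=> k1; have -> : dyadic_pos_part f delta i k =
      [set x | dyadic_level delta i k < f x] `\`
      [set x | dyadic_level delta i k.+1 < f x].
    apply/seteqP; split=> x; rewrite /dyadic_pos_part /= in_itv/=.
      by move=> /andP[-> fk]; split=> //; apply/negP; rewrite -leNgt.
    by move=> [-> /negP]; rewrite -leNgt.
  by apply: (field_setD hFbar); apply: Fgt; apply: contp.
have Fneg i k : (1 <= k)%N -> Fbar (dyadic_neg_part f delta i k).
  move=> k1; have -> : dyadic_neg_part f delta i k =
      [set x | f x < - dyadic_level delta i k] `\`
      [set x | f x < - dyadic_level delta i k.+1].
    apply/seteqP; split=> x; rewrite /dyadic_neg_part /= in_itv/=.
      by move=> /andP[fk ->]; split=> //; apply/negP; rewrite -leNgt.
    by move=> [-> /negP]; rewrite -leNgt => ->.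
  by apply: (field_setD hFbar); apply: Flt; apply: contn.
pose s i x := \sum_(1 <= k < (i * 2 ^ i - 1).+1) dyadic_level delta i k *
  (\1_(dyadic_pos_part f delta i k) x - \1_(dyadic_neg_part f delta i k) x).
have sE i x : (1 <= i)%N ->
    s i x = dyadic_sum (2 ^- i * delta) (i * 2 ^ i) (f x).
  move=> i1; rewrite /s /dyadic_sum subn1 prednK ?muln_gt0 ?i1 ?expn_gt0//.
  apply: eq_bigr => k _; rewrite !indicE !mulrA /dyadic_level.
  congr (_ * (_%:R - _%:R)).
    congr nat_of_bool; apply/idP/idP.
      by move=> /set_mem; rewrite /dyadic_pos_part /= in_itv.
    by move=> h; apply/mem_set; rewrite /dyadic_pos_part /= in_itv.
  congr nat_of_bool; rewrite ltrNr lerNl andbC; apply/idP/idP.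
    by move=> /set_mem; rewrite /dyadic_neg_part /= in_itv.
  by move=> h; apply/mem_set; rewrite /dyadic_neg_part /= in_itv.
exists s; split.
- move=> i _; apply: (sum_indicB_closed (P := simple_function Fbar)) _ _ _;
    [exact: (simple_cst hFbar)|exact: (simple_op2 hFbar)|].
  move=> k /andP[k1 _].
  by split; apply: simple_indic => //; [exact: Fpos|exact: Fneg].
- apply/(hazilyP hmu) => e e0; have [k k0 /outer_chargeP[B [FB kB Be]]] := sf e e0.
  have ed : 0 < e / delta by rewrite divr_gt0.
  near=> i; exists B; split=> // x /= ex; apply: kB => /=.
  rewrite ltNge; apply/negP => fk.
  move: ex; apply/negP; rewrite -leNgt.
  have i1 : (1 <= i)%N by near: i; exact: nbhs_infty_ge.
  have h0 : 0 < 2 ^- i * delta by rewrite mulr_gt0// invr_gt0 exprn_gt0.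
  rewrite sE//; apply: le_trans (dyadic_sum_dist h0 _ _) _.
  + by rewrite muln_gt0 i1 expn_gt0.
  + rewrite natrM natrX -mulrA mulVKf ?expf_neq0 ?pnatr_eq0//.
    rewrite (le_trans fk)// -ler_pdivrMr//.
    by near: i; exact: nbhs_infty_ger.
  + rewrite -ler_pdivlMr// -div1r ltW//.
    by near: i; exact: (near_infty_natSinv_expn_lt (PosNum ed)).
- exists delta => // i i1; split=> [k /andP[k1 _]|x].
    by split; [exact: Fpos|exact: Fneg].
  by [].
Unshelve. all: by end_near. Qed.

End HazyApproximation.

(** * The equivalences *)

Theorem theorem3p3 (R : realType) (X : Type) (F : set (set X))
    (mu : set X -> \bar R) (f : X -> R)
    (hF : is_field_of_sets F) (hmu : is_charge F mu)
    (hphi : dense (boundary_mass_limit F mu f @^-1`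
                     [set t : \bar R | (0 <= t < +oo)%E])) :
  [<-> ray_measurable F mu f;
       left_ray_measurable F mu f;
       right_ray_measurable F mu f;
       completion_measurable F mu f;
       base_measurable F mu f^\+ /\ base_measurable F mu f^\-;
       base_measurable F mu f /\
         exists y : R, pj_completion F mu (f @^-1` `]y, +oo[)]
  /\
  [<-> regularly_T1_measurable F mu f;
       T1_measurable F mu f;
       T2_measurable F mu f;
       ray_measurable F mu f /\ smooth F mu f;
       base_measurable F mu f /\ smooth F mu f].
Proof.
have rayP : ray_separated F mu f -> ray_measurable F mu f.
  by move=> sep; exact: ray_separated_ray_measurable.
split; tfae.
- exact: ray_measurable_left.
- move=> /(left_ray_measurable_separated hF hmu)/rayP; exact: ray_measurable_right.
- exact: right_ray_measurable_completion.
- move=> /(completion_measurable_separated hF)/rayP rf; split.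
    exact/ray_measurable_base/ray_measurable_pos.
  (* [f^\-] is by definition the positive part of [- f]. *)
  apply: ray_measurable_base => //.
  apply: (@ray_measurable_pos _ _ _ _ _ _ (\- f)) => //.
  exact: ray_measurable_opp.
- move=> [/(base_measurable_pos_neg_separated hF hmu) sep /sep/rayP rf].
  split; first exact: ray_measurable_base.
  have [D [dD FD]] := rf; have [y Dy _] := dense_itv dD (@ltr01 R).
  by exists y; have [] := FD y Dy.
- move=> [bf [y Fy]]; apply: rayP; apply: base_measurable_separated bf _ => //.
  by rewrite -preimage_ray_gt; exact: Fy.
- exact: regularly_T1_T1.
- exact: T1_T2.
- move=> T2; split; last exact: T2_smooth.
  exact/rayP/T2_separated.
- by move=> [rf sf]; split=> //; exact: ray_measurable_base.
- move=> [bf sf]; apply: separated_smooth_regularly_T1 => //.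
  exact: smooth_base_measurable_separated.
Qed.
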